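(* Let $k\ge 3$ be odd and let $G=(V,E)$ be a $k$-uniform hyperstar of size $d>0$. Let $\mathcal L$ be the Laplacian tensor of $G$. Then $\lambda(\mathcal L)=d$.
   Context: A $k$-uniform hypergraph $G=(V,E)$ has vertex set $V=[n]=\{1,\dots,n\}$ and edges that are $k$-element subsets of $V$. It is a hyperstar of size $d\ge1$ if there is a disjoint partition $V=V_0\cup V_1\cup\dots\cup V_d$ with $|V_0|=1$, $|V_1|=\dots=|V_d|=k-1$ and $E=\{V_0\cup V_i : i\in[d]\}$. The degree $d_i$ of vertex $i$ is the number of edges containing $i$. The adjacency tensor $\mathcal A$ is the $k$-th order $n$-dimensional tensor with $a_{i_1\dots i_k}=\frac1{(k-1)!}$ if $\{i_1,\dots,i_k\}\in E$ and $0$ otherwise; $\mathcal D$ is the diagonal tensor with diagonal entries $d_{i\dots i}=d_i$; the Laplacian tensor is $\mathcal L=\mathcal D-\mathcal A$. Thus $(\mathcal L\mathbf x^{k-1})_i=d_ix_i^{k-1}-\sum_{e\in E,\,i\in e}\prod_{j\in e\setminus\{i\}}x_j$. A real number $\lambda$ is an H-eigenvalue of $\mathcal L$ with H-eigenvector $\mathbf x\in\mathbb R^n\setminus\{0\}$ if $(\mathcal L\mathbf x^{k-1})_i=\lambda x_i^{k-1}$ for all $i\in[n]$. $\lambda(\mathcal L)$ denotes the largest H-eigenvalue of $\mathcal L$ (it exists). *)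

(* Defs.v *)
From mathcomp Require Import all_boot all_order all_algebra.
From mathcomp Require Import reals.

Set Implicit Arguments.
Unset Strict Implicit.
Unset Printing Implicit Defensive.

Import Order.TTheory GRing.Theory Num.Theory.

Local Open Scope ring_scope.

Record uhypergraph (n k : nat) := UHypergraph {
  edges :> {set {set 'I_n}};
  edges_uniform : forall e, e \in edges -> #|e| = k
}.

Definition hyperstar (n k d : nat) (G : uhypergraph n k) : Prop :=
  (0 < d)%N /\
  exists (V0 : {set 'I_n}) (V : 'I_d -> {set 'I_n}),
    [/\ #|V0| = 1%N /\ (forall i, #|V i| = k.-1),
        forall i, [disjoint V0 & V i],
        forall i j, i != j -> [disjoint V i & V j],
        V0 :|: \bigcup_i V i = [set: 'I_n]
      & edges G = [set V0 :|: V i | i in 'I_d]].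

Definition degree (n k : nat) (G : uhypergraph n k) (i : 'I_n) : nat :=
  #|[set e in edges G | i \in e]|.

Notation tensor R n k := {ffun k.-tuple 'I_n -> R}.

(* The entry of the vector T x^{k-1} at i is the sum of
   t_{i i_2 ... i_k} x_{i_2} ... x_{i_k} over all i_2, ..., i_k; the tuples
   (i, i_2, ..., i_k) are the k-tuples whose head is i. *)
Definition tensor_app (R : realType) (n k : nat) (T : tensor R n k)
    (x : 'rV[R]_n) (i : 'I_n) : R :=
  \sum_(t : k.-tuple 'I_n | ohead t == Some i)
    T t * \prod_(j <- behead t) x 0 j.

Definition diag_tensor (R : realType) (n k : nat) (f : 'I_n -> R) :
    tensor R n k :=
  [ffun t : k.-tuple 'I_n =>
     (if ohead t is Some i then if t == nseq_tuple k i then f i else 0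
      else 0) : R].

Definition degree_tensor (R : realType) (n k : nat) (G : uhypergraph n k) :
    tensor R n k :=
  diag_tensor k (fun i => (degree G i)%:R).

(* As the edges have k elements, [set j in t] \in edges G forces the
   k indices in t to be distinct. *)
Definition adjacency_tensor (R : realType) (n k : nat) (G : uhypergraph n k) :
    tensor R n k :=
  [ffun t : k.-tuple 'I_n =>
     (if [set j in t] \in edges G then (k.-1)`!%:R^-1 else 0) : R].

Definition laplacian_tensor (R : realType) (n k : nat) (G : uhypergraph n k) :
    tensor R n k :=
  degree_tensor R G - adjacency_tensor R G.

Definition H_eigenvalue (R : realType) (n k : nat) (T : tensor R n k)
    (lam : R) : Prop :=
  exists2 x : 'rV[R]_n,
    x != 0 & forall i, tensor_app T x i = lam * x 0 i ^+ k.-1.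

Definition largest_H_eigenvalue (R : realType) (n k : nat) (T : tensor R n k)
    (lam : R) : Prop :=
  H_eigenvalue T lam /\ forall mu : R, H_eigenvalue T mu -> mu <= lam.

(* Main.v *)
(** The indicator vector of the center is an H-eigenvector for [d].
    Conversely, let [x] be an H-eigenvector for some [lam > d >= 1], with value
    [x0] at the center.  Multiplying the equation of a vertex [i] of [V_j] by
    [x_i] gives [(1 - lam) x_i ^ k = x0 P_j], where [P_j] is the product of [x]
    over [V_j].  Hence [x_i ^ k] is constant on [V_j], so [P_j ^ k] is a
    [(k-1)]-st power with [k - 1] even, and [P_j >= 0] because [k] is odd.  The
    equation of the center, [(d - lam) x0 ^ (k-1) = \sum_j P_j], then forces
    [x0 = 0], and the other equations force [x = 0]. *)

Require Import Defs.
From mathcomp Require Import all_boot all_order all_algebra.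
From mathcomp Require Import reals.

Set Implicit Arguments.
Unset Strict Implicit.
Unset Printing Implicit Defensive.

Import Order.TTheory GRing.Theory Num.Theory.

Local Open Scope ring_scope.

Section TensorApplication.

Variables (R : realType) (n k : nat).
Implicit Types (T : tensor R n k.+1) (G : uhypergraph n k.+1) (x : 'rV[R]_n).

Lemma tensor_appE T x i :
  tensor_app T x i =
  \sum_(s : k.-tuple 'I_n) T [tuple of i :: s] * \prod_(j <- s) x 0 j.
Proof.
rewrite /tensor_app (reindex (fun s : k.-tuple 'I_n => [tuple of i :: s])) /=.
  by apply: eq_bigl => s; rewrite eqxx.
exists (fun t : k.+1.-tuple 'I_n => [tuple of behead t]) => [s _ | t].
  exact: val_inj.
case/tupleP: t => j s; rewrite inE /= => /eqP[->]; exact: val_inj.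
Qed.

Lemma tensor_appB T U x i :
  tensor_app (T - U) x i = tensor_app T x i - tensor_app U x i.
Proof.
rewrite /tensor_app -sumrB; apply: eq_bigr => t _.
by rewrite !ffunE mulrBl.
Qed.

Lemma diag_tensor_app (f : 'I_n -> R) x i :
  tensor_app (diag_tensor k.+1 f) x i = f i * x 0 i ^+ k.
Proof.
rewrite tensor_appE (bigD1 (nseq_tuple k i)) //= [X in _ + X]big1 ?addr0 => [|s ne_s].
  by rewrite ffunE /= -val_eqE /= eqxx big_nseq iter_mulr_1.
rewrite ffunE /= -val_eqE /= eqseq_cons eqxx /=.
by rewrite -val_eqE /= in ne_s; rewrite (negPf ne_s) mul0r.
Qed.

(** The tuple [i :: s] has exactly [#|e|] entries, so it can only cover [e] without repetition.
    Hence [s] is an arrangement of [e :\ i], a form that [card_uniq_tuples] counts. *)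
Lemma set_cons_eq (e : {set 'I_n}) i (s : k.-tuple 'I_n) :
    #|e| = k.+1 -> i \in e ->
  ([set j in i :: s] == e) =
    (s \in [set s : k.-tuple 'I_n | all (mem (e :\ i)) s & uniq s]).
Proof.
move=> card_e ie; rewrite inE; apply/eqP/andP => [def_e | [/allP sub_s uniq_s]].
  have: uniq (i :: s).
    by apply/card_uniqP; rewrite /= size_tuple -card_e -def_e cardsE.
  rewrite cons_uniq => /andP[nis ->]; split=> //; apply/allP=> j js.
  by rewrite /= -def_e !inE js orbT andbT; apply: contraNneq nis => <-.
have nis : i \notin s by apply/negP => /sub_s /=; rewrite !inE eqxx.
apply/eqP; rewrite eqEcard card_e cardsE; apply/andP; split.
  apply/subsetP=> j; rewrite !inE => /predU1P[-> // | /sub_s /=].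
  by rewrite !inE => /andP[].
have /card_uniqP -> : uniq (i :: s) by rewrite /= nis.
by rewrite /= size_tuple.
Qed.

(** Group the tuples by the edge they cover: each edge through [i] comes from the [k!] orderings of
    its other [k] vertices, all with the same product, and this cancels the entry [1 / k!]. *)
Lemma adjacency_tensor_app G x i :
  tensor_app (adjacency_tensor R G) x i =
  \sum_(e in edges G | i \in e) \prod_(j in e :\ i) x 0 j.
Proof.
rewrite tensor_appE.
rewrite (bigID (fun s : k.-tuple 'I_n => [set j in i :: s] \in edges G)) /=.
rewrite [X in _ + X]big1 ?addr0 => [|s /negPf nEs]; last first.
  by rewrite ffunE nEs mul0r.
rewrite (partition_big (fun s : k.-tuple 'I_n => [set j in i :: s])
          (fun e => (e \in edges G) && (i \in e))) /= => [|s ->]; last first.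
  by rewrite !inE eqxx.
apply: eq_bigr => e /andP[Ee ie]; have card_e := edges_uniform Ee.
have card_ei : #|e :\ i| = k by apply/eqP; rewrite -eqSS -card_e (cardsD1 i e) ie.
transitivity (\sum_(s in [set s : k.-tuple 'I_n | all (mem (e :\ i)) s & uniq s])
   (k`!%:R^-1 * \prod_(j in e :\ i) x 0 j)).
  apply: eq_big => s.
    rewrite -set_cons_eq //; apply: andb_idl => /eqP -> //.
  case/andP=> Es /eqP def_e; rewrite ffunE Es; congr (_ * _).
  have: s \in [set s : k.-tuple 'I_n | all (mem (e :\ i)) s & uniq s].
    by rewrite -set_cons_eq // def_e.
  rewrite inE => /andP[_ uniq_s]; rewrite big_uniq //=.
  apply: eq_bigl => j; rewrite -def_e !inE.
  (* Distinctness gives [i \notin s], so removing [i] from the edge leaves exactly the entries of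
     [s]. *)
  have : uniq (i :: s).
    by apply/card_uniqP; rewrite /= size_tuple -card_e -def_e cardsE.
  case/andP=> nis _; case: eqP => [-> | _] //=; exact: negbTE.
rewrite sumr_const card_uniq_tuples card_ei ffactnn -[LHS]mulr_natl mulrA.
by rewrite divff ?mul1r // pnatr_eq0 -lt0n fact_gt0.
Qed.

Lemma laplacian_tensor_app G x i :
  tensor_app (laplacian_tensor R G) x i =
  (degree G i)%:R * x 0 i ^+ k
    - \sum_(e in edges G | i \in e) \prod_(j in e :\ i) x 0 j.
Proof. by rewrite tensor_appB diag_tensor_app adjacency_tensor_app. Qed.

End TensorApplication.

Section Hyperstar.

Variables (n k d : nat) (G : uhypergraph n k.+1).
Variables (v0 : 'I_n) (V : 'I_d -> {set 'I_n}).
Hypothesis k_gt0 : (0 < k)%N.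
Hypothesis cardV : forall i, #|V i| = k.
Hypothesis v0V : forall i, v0 \notin V i.
Hypothesis disjV : forall i j, i != j -> [disjoint V i & V j].
Hypothesis EG : edges G = [set v0 |: V i | i in 'I_d].

(** Disjointness of the [V i] places a leaf in a single edge, which collapses sums over its edges to
    one term. *)
Lemma leaf_in_edge a i j : a \in V j -> (a \in v0 |: V i) = (i == j).
Proof.
move=> aV; rewrite !inE.
have -> /= : (a == v0) = false by apply: contraTF aV => /eqP ->; exact: v0V.
apply/idP/eqP => [aVi | -> //]; apply/eqP/negPn/negP => /disjV/pred0P/(_ a).
by rewrite /= aVi aV.
Qed.

(** Any vertex of the nonempty [V j] identifies its edge. Sums over edges can thus be indexed by
    ['I_d] without multiplicity. *)
Lemma hyperstar_edge_inj : injective (fun i => v0 |: V i).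
Proof.
move=> i j eq_ij; have /card_gt0P[a aV] : (0 < #|V j|)%N by rewrite cardV.
by apply/eqP; rewrite -(leaf_in_edge i aV) eq_ij !inE aV orbT.
Qed.

Lemma hyperstar_sum (M : nmodType) (F : {set 'I_n} -> M) a :
  \sum_(e in edges G | a \in e) F e =
  \sum_(i < d | a \in v0 |: V i) F (v0 |: V i).
Proof.
rewrite EG big_imset_cond //=; move=> i j _ _; exact: hyperstar_edge_inj.
Qed.

Lemma center_degree : degree G v0 = d.
Proof.
rewrite /degree cardsE -sum1_card hyperstar_sum.
by rewrite (eq_bigl xpredT) ?sum1_card ?card_ord // => i; rewrite !inE eqxx.
Qed.

Lemma leaf_degree a j : a \in V j -> degree G a = 1%N.
Proof.
move=> aV; rewrite /degree cardsE -sum1_card hyperstar_sum (big_pred1 j) //.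
by move=> i; exact: leaf_in_edge.
Qed.

Variables (R : realType) (x : 'rV[R]_n).

Lemma laplacian_center :
  tensor_app (laplacian_tensor R G) x v0 =
  d%:R * x 0 v0 ^+ k - \sum_(i < d) \prod_(a in V i) x 0 a.
Proof.
rewrite laplacian_tensor_app center_degree hyperstar_sum; congr (_ - _).
apply: eq_big => [i | i _]; first by rewrite !inE eqxx.
by rewrite setU1K.
Qed.

Lemma laplacian_leaf a j : a \in V j ->
  tensor_app (laplacian_tensor R G) x a =
  x 0 a ^+ k - x 0 v0 * \prod_(b in V j :\ a) x 0 b.
Proof.
move=> aV; rewrite laplacian_tensor_app (leaf_degree aV) mul1r hyperstar_sum.
rewrite (big_pred1 j) => [|i]; last exact: leaf_in_edge.
congr (_ - _); have v0a : v0 != a by apply: contraNneq (v0V j) => ->.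
rewrite (bigD1 v0) /=; last by rewrite !inE v0a eqxx.
congr (_ * _); apply: eq_bigl => b; rewrite !inE.
by case: (eqVneq b v0) => [-> | _]; rewrite ?(negPf (v0V j)) ?andbF ?andbT.
Qed.

End Hyperstar.

(** The power [#|A|.+1] of the product is [c ^+ #|A|], an even power, and an odd exponent preserves
    the sign of its base. *)
Lemma prodr_ge0_of_odd_exp_const (R : realDomainType) (I : finType)
    (A : {set I}) (f : I -> R) (c : R) :
    ~~ odd #|A| -> {in A, forall i, f i ^+ #|A|.+1 = c} ->
  0 <= \prod_(i in A) f i.
Proof.
move=> evA fc; rewrite -(@exprn_odd_ge0 _ #|A|.+1) //= -prodrXl.
by rewrite (eq_bigr _ fc) prodr_const exprn_even_ge0.
Qed.

Theorem theorem3p5 (R : realType) (n k d : nat) (hk : (3 <= k)%N)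
    (kodd : odd k) (hd : (0 < d)%N) (G : uhypergraph n k)
    (hG : hyperstar d G) :
  largest_H_eigenvalue (laplacian_tensor R G) d%:R.
Proof.
(* From here on the uniformity is [k.+1], so [k] is even and at least 2. *)
case: k hk kodd G hG => // k; rewrite ltnS => k_gt1 /= k_even G.
case=> _ [V0 [V [[/eqP/cards1P[v0 ->] cardV] disjV0 disjV coverV EG]]].
have k_gt0 : (0 < k)%N by exact: ltnW.
have v0V i : v0 \notin V i by have := disjV0 i; rewrite disjoints1.
have center := laplacian_center k_gt0 cardV v0V disjV EG.
have leaf := laplacian_leaf k_gt0 cardV v0V disjV EG.
have vertexP a : a = v0 \/ exists j, a \in V j.
  have: a \in [set v0] :|: \bigcup_i V i by rewrite coverV inE.
  by rewrite !inE => /orP[/eqP | /bigcupP[j _ aV]]; [left | right; exists j].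
split=> [|mu [x x_neq0 eigx]].
  exists (delta_mx 0 v0 : 'rV[R]_n).
    apply/eqP => /rowP/(_ v0)/eqP; rewrite !mxE !eqxx /=; exact/negP/oner_neq0.
  have delta0 j b : b \in V j -> (delta_mx 0 v0 : 'rV[R]_n) 0 b = 0.
    by move=> bV; rewrite mxE eqxx; case: eqP bV (v0V j) => // -> ->.
  have prod0 j (A : {set 'I_n}) : A \subset V j -> (0 < #|A|)%N ->
      \prod_(b in A) (delta_mx 0 v0 : 'rV[R]_n) 0 b = 0.
    move=> /subsetP sAV /card_gt0P[b bA].
    by rewrite (bigD1 b) //= (delta0 j) ?mul0r ?sAV.
  move=> a; have [-> | [j aV]] := vertexP a.
    rewrite center big1 ?subr0 // => j _.
    by rewrite (prod0 j) // cardV.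
  (* The center has value 1, so the leaf equation holds only because the product over the other
     leaves of the edge has a zero factor; such a leaf exists since [1 < k]. *)
  have Va_gt0 : (0 < #|V j :\ a|)%N.
    have: (1 < #|V j|)%N by rewrite cardV.
    by rewrite (cardsD1 a) aV.
  rewrite (leaf _ _ _ _ aV) (delta0 j a aV) (prod0 j) ?subD1set //.
  by rewrite expr0n eqn0Ngt k_gt0 !mulr0 subr0.
rewrite leNgt; apply/negP => mu_gt.
have mu_neq1 : 1 - mu != 0.
  by rewrite subr_eq0 lt_eqF // (le_lt_trans _ mu_gt) // ler1n.
have leaf_eq a j : a \in V j ->
    (1 - mu) * x 0 a ^+ k = x 0 v0 * \prod_(b in V j :\ a) x 0 b.
  move=> aV; have := eigx a; rewrite (leaf _ _ _ _ aV) => /eqP.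
  by rewrite subr_eq addrC -subr_eq mulrBl mul1r => /eqP.
have prod_ge0 j : 0 <= \prod_(a in V j) x 0 a.
  (* The constant is the leaf equation multiplied by [x 0 a] and solved for [x 0 a ^+ k.+1]: the
     extra factor completes the product to all of [V j], removing the dependence on [a]. *)
  apply: (@prodr_ge0_of_odd_exp_const _ _ _ _
           ((1 - mu)^-1 * (x 0 v0 * \prod_(a in V j) x 0 a))).
    by rewrite cardV.
  move=> a aV; rewrite cardV; apply: (mulfI mu_neq1).
  rewrite exprSr mulrA (leaf_eq _ _ aV) mulVKf // -mulrA; congr (_ * _).
  by rewrite (big_setD1 a aV) mulrC.
have x0 : x 0 v0 = 0.
  have xk_ge0 : 0 <= x 0 v0 ^+ k by rewrite exprn_even_ge0.
  have eq0 : (d%:R - mu) * x 0 v0 ^+ k = \sum_(j < d) \prod_(a in V j) x 0 a.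
    by have/eqP := eigx v0; rewrite center subr_eq addrC -subr_eq -mulrBl => /eqP.
  suff: x 0 v0 ^+ k == 0 by rewrite expf_eq0 k_gt0 => /eqP.
  (* A negative factor times [x 0 v0 ^+ k] equals a sum of nonnegative products, so this power is
     also at most 0. *)
  rewrite eq_le xk_ge0 andbT -(nmulr_rge0 _ (_ : d%:R - mu < 0)) ?subr_lt0 //.
  by rewrite eq0 sumr_ge0.
case/eqP: x_neq0; apply/rowP => a; rewrite mxE.
have [-> // | [j aV]] := vertexP a.
have /eqP := leaf_eq a j aV.
by rewrite x0 mul0r mulf_eq0 (negPf mu_neq1) expf_eq0 k_gt0 => /eqP.
Qed.
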